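(* Suppose $f(x)\in\mathbb{R}[x]$ is monic and separable of degree $n\geq 2$ and signature $(t,s)$, where $s=0$, or $(t,s)=(1,1)$, or $(t,s)=(0,2)$. Then \[\operatorname{sep}(f)\leq C_{t,s}\,M(f)^{1/(n-\delta)},\] where $\delta=1$ if $t\neq 0$ and $\delta=0$ if $t=0$, and where $C_{1,1}=\sqrt{3}$, $C_{0,2}=\sqrt{2}$, and $C_{t,0}=(2e+o(1))/t$. Here $o(1)$ denotes a quantity depending only on $t$ that tends to $0$ as $t\to\infty$; that is, there is a function $\varepsilon:\{2,3,\dots\}\to\mathbb{R}$ with $\varepsilon(t)\to 0$ as $t\to\infty$ such that the inequality holds with $C_{t,0}=(2e+\varepsilon(t))/t$ for every $t\geq 2$ and every such $f$ of signature $(t,0)$.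
   Context: For a polynomial $f(x)\in\mathbb{C}[x]$ with roots $\alpha_1,\dots,\alpha_n\in\mathbb{C}$, the separation of $f$ is $\operatorname{sep}(f) := \min_{\alpha_i\neq\alpha_j}|\alpha_i-\alpha_j|$. For a monic polynomial $f(x)\in\mathbb{C}[x]$ with roots $\alpha_1,\dots,\alpha_n$ (with multiplicity), the Mahler measure of $f$ is $M(f) := \prod_{i=1}^n\max\{1,|\alpha_i|\}$. Separable means that $f$ has $n=\deg f$ distinct complex roots. A polynomial $f(x)\in\mathbb{R}[x]$ has signature $(t,s)$ if it has $t$ real roots and $s$ pairs of complex conjugate (nonreal) roots, so that $n=t+2s$. *)

(* Defs.v *)
From mathcomp Require Import all_boot all_order all_algebra.
From mathcomp Require Import all_classical all_reals all_analysis.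
From mathcomp Require Export complex.

Set Implicit Arguments.
Unset Strict Implicit.
Unset Printing Implicit Defensive.

Import Order.TTheory GRing.Theory Num.Theory.

Local Open Scope ring_scope.
Local Open Scope complex_scope.

Section SepMahler.
Variable R : realType.
Implicit Types (p : {poly R[i]}) (f : {poly R}) (z : R[i]).

(* The roots of p with multiplicity; junk value for p = 0. *)
Definition croots p : seq R[i] := sval (closed_field_poly_normal p).

(* The modulus as an element of R: the library's `|z| is valued in R[i]. *)
Definition cmod z : R := complex.Re `|z|.

Definition root_distances p : seq R :=
  [seq cmod (ab.1 - ab.2)
     | ab <- [seq (a, b) | a <- croots p, b <- croots p] & ab.1 != ab.2].

(* The minimum of the list root_distances p; junk value 0 when p has fewer
   than two distinct roots (head is also the initial value of the fold, so it
   contributes nothing new otherwise). *)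
Definition sep p : R :=
  \big[Num.min/head 0 (root_distances p)]_(d <- root_distances p) d.

(* Meant for monic p: there is no factor for the leading coefficient. *)
Definition mahler p : R := \prod_(a <- croots p) Num.max 1 (cmod a).

Definition separable p : Prop := size (undup (croots p)) = (size p).-1.

Definition complexify f : {poly R[i]} := map_poly (real_complex R) f.

(* The nonreal roots of a real polynomial come in conjugate pairs, so
   "s pairs" means that there are 2s of them. *)
Definition has_signature f (t s : nat) : Prop :=
  count (fun z => complex.Im z == 0) (croots (complexify f)) = t /\
  count (fun z => complex.Im z != 0) (croots (complexify f)) = s.*2.

(* The last branch is never used: only s = 0, (1, 1) and (0, 2) are allowed. *)
Definition sep_const (eps : nat -> R) (t s : nat) : R :=
  match t, s with
  | _, 0 => (2 * expR 1 + eps t) / t%:R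
  | 1, 1 => Num.sqrt 3
  | 0, 2 => Num.sqrt 2
  | _, _ => 0
  end.

Definition delta (t : nat) : R := if t == 0%N then 0 else 1.

End SepMahler.

(* Main.v *)
(* Totally real case: listing the roots by increasing modulus, an interval
   [-r, r] containing k + 1 of them satisfies 2 r >= k sep(f), so the k-th
   modulus is at least k sep(f) / 2; multiplying over k gives
   M(f) >= (n-1)! (sep(f) / 2)^(n-1), and k! >= (k / e)^k yields
   eps(t) = 2e / (t - 1).  In the other two cases sep(f) is bounded by twice the
   imaginary part of each nonreal root and by the distances between roots from
   different conjugacy classes, which leaves an elementary inequality with
   extremal configurations the cube roots of 1 and the square with vertices
   (+/- 1 +/- i) / sqrt 2. *)

Require Import Defs.
From mathcomp Require Import all_boot all_order all_algebra.
From mathcomp Require Import all_classical all_reals all_analysis.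
From mathcomp Require Import ring lra.
Import Order.TTheory GRing.Theory Num.Theory.
Import numFieldNormedType.Exports.
Local Open Scope classical_set_scope.
Local Open Scope ring_scope.

(** * Products of moduli of well-spaced real numbers *)

Lemma path_spaced_last (R : realDomainType) (d x : R) (s : seq R) :
  path (fun a b => a + d <= b) x s -> x + d * (size s)%:R <= last x s.
Proof.
elim: s x => [|y s IHs] x /=; first by rewrite mulr0 addr0.
move=> /andP[xy /IHs]; apply: le_trans.
by rewrite -natr1 mulrDr mulr1; lra.
Qed.

(** In increasing order consecutive points are at least [d] apart, so the two extreme points differ
    by at least [d] times the number of gaps. One of them therefore has at least half of this as its
    modulus. *)
Lemma exists_large_of_spaced (R : realFieldType) (d : R) (s : seq R) :
  (0 < size s)%N -> uniq s ->
  {in s &, forall x y, x != y -> d <= `|x - y|} ->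
  exists2 x, x \in s & d * (size s).-1%:R <= 2 * `|x|.
Proof.
move=> s_gt0 s_uniq s_spaced.
have mem_sort_s := mem_sort <=%O s.
have := size_sort <=%O s; have := sort_lt_sorted s; rewrite s_uniq.
case E: (sort _ s) mem_sort_s => [|y u] mem_yu srt size_yu.
  by rewrite -size_yu in s_gt0.
have : sorted (fun a b => a + d <= b) (y :: u).
  apply: (@sub_in_sorted _ (mem s) <%O) srt; last first.
    by apply/allP => z; rewrite mem_yu.
  move=> a b a_s b_s ab; have := s_spaced _ _ b_s a_s; rewrite gt_eqF// => /(_ isT).
  by rewrite gtr0_norm ?subr_gt0// lerBrDl.
move=> /path_spaced_last; rewrite -size_yu /= => spread.
have [y_large|y_small] := leP (d * (size u)%:R) (2 * `|y|).
  by exists y => //; rewrite -mem_yu mem_head.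
exists (last y u); first by rewrite -mem_yu mem_last.
have := ler_norm (last y u); have := ler_norm (- y); rewrite normrN.
by set k := d * _ in spread y_small *; lra.
Qed.

(* Removing an element of largest modulus shows inductively that the k-th
   smallest modulus, counted from k = 0, is at least k d / 2. *)
Lemma prod_max1_norm_ge (R : realFieldType) (d : R) (s : seq R) :
  0 <= d -> uniq s -> {in s &, forall x y, x != y -> d <= `|x - y|} ->
  (d / 2) ^+ (size s).-1 * ((size s).-1)`!%:R <= \prod_(x <- s) Num.max 1 `|x|.
Proof.
move=> d_ge0; move: {2}(size s) (erefl (size s)) => n.
elim: n s => [|n IHn] s size_s s_uniq s_spaced.
  by rewrite (size0nil size_s) big_nil /= expr0 mul1r.
have [|x x_s x_large] := @exists_large_of_spaced _ d s _ s_uniq s_spaced.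
  by rewrite size_s.
rewrite (big_rem x)//=.
have size_rem_s : size (rem x s) = n by rewrite size_rem// size_s.
have {IHn} := IHn _ size_rem_s (rem_uniq x s_uniq) _.
rewrite size_s size_rem_s /=; rewrite size_s /= in x_large => IHn.
have {}IHn := IHn (fun a b a_s b_s => s_spaced a b (mem_rem a_s) (mem_rem b_s)).
(* A single point contributes only the trivial factor [Num.max 1 _ >= 1]. From two points on, the
   removed one supplies the factor [d / 2] times the number of remaining points, which is what the
   power and the factorial gain. *)
case: n {size_s size_rem_s} IHn x_large => [|n] IHn x_large.
  rewrite expr0 mul1r fact0 in IHn *.
  by rewrite -[leLHS]mulr1 ler_pM// le_max lexx.
rewrite exprS factS natrM mulrACA; apply: ler_pM => //.
- by rewrite mulr_ge0 ?divr_ge0.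
- by rewrite mulr_ge0 ?exprn_ge0 ?divr_ge0.
- by rewrite le_max mulrAC; apply/orP; right; rewrite ler_pdivrMr// [leRHS]mulrC.
Qed.

(** By induction: passing from m to m + 1 multiplies m^m by (m + 1) (1 + 1/m)^m, and (1 + 1/m)^m <=
    e. The passage from 0 to 1 is separate because of the division by m. *)
Lemma expn_le_fact_exp (R : realType) (k : nat) :
  (k%:R : R) ^+ k <= k`!%:R * expR 1 ^+ k.
Proof.
elim: k => [|k IHk]; first by rewrite !expr0 mulr1.
case: k IHk => [|k] IHk.
  by rewrite expr1 mul1r expr1 (le_trans _ (expR_ge1Dx 1))// lerDl.
rewrite exprS factS natrM [expR 1 ^+ _]exprSr -mulrA ler_pM2l// mulrA.
set m := k.+1 in IHk *; have m_gt0 : 0 < m%:R :> R by [].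
have : (1 + m%:R^-1) ^+ m <= expR (1 : R).
  rewrite -[X in expR X](@mulfV _ m%:R) ?gt_eqF// expRM_natl.
  by rewrite lerXn2r ?expR_ge1Dx// nnegrE ?expR_ge0 ?addr_ge0 ?invr_ge0.
have -> : m.+1%:R = m%:R * (1 + m%:R^-1) :> R.
  by rewrite mulrDr mulr1 mulfV ?gt_eqF// natr1.
by move=> e_ge; rewrite exprMn ler_pM ?exprn_ge0// addr_ge0 ?invr_ge0.
Qed.

Lemma le_mul_powR_inv (R : realType) (c d m : R) (k : nat) :
  (0 < k)%N -> 0 <= d -> 0 < c -> d ^+ k <= c ^+ k * m -> d <= c * m `^ k%:R^-1.
Proof.
move=> k_gt0 d_ge0 c_gt0 dm; rewrite mulrC -ler_pdivrMr//.
have q_ge0 : 0 <= d / c by rewrite divr_ge0// ltW.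
have qm : (d / c) ^+ k <= m.
  by rewrite expr_div_n ler_pdivrMr ?exprn_gt0// mulrC.
have {1}-> : d / c = ((d / c) ^+ k) `^ k%:R^-1.
  by rewrite -powR_mulrn// -powRrM mulfV ?powRr1// pnatr_eq0 -lt0n.
apply: ge0_ler_powR; rewrite ?invr_ge0 ?nnegrE ?exprn_ge0//.
by rewrite (le_trans _ qm)// exprn_ge0.
Qed.

Lemma spaced_le_prod_powR (R : realType) (d : R) (s : seq R) :
  (2 <= size s)%N -> 0 <= d -> uniq s ->
  {in s &, forall x y : R, x != y -> d <= `|x - y|} ->
  d <= 2 * expR 1 / (size s).-1%:R
       * (\prod_(x <- s) Num.max 1 `|x|) `^ (size s).-1%:R^-1.
Proof.
move=> s_ge2 d_ge0 s_uniq /(prod_max1_norm_ge _ _ _ d_ge0 s_uniq).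
set k := (size s).-1; set m := \prod_(_ <- _) _ => m_ge.
have k_gt0 : (0 < k)%N by rewrite /k -subn1 subn_gt0.
have k_gt0R : 0 < k%:R :> R by rewrite ltr0n.
have e_gt0 := expR_gt0 (1 : R).
apply: le_mul_powR_inv; rewrite ?divr_gt0 ?mulr_gt0//.
have d2_ge0 : 0 <= (d / 2) ^+ k by rewrite exprn_ge0// divr_ge0.
have : (d / 2) ^+ k * k%:R ^+ k <= m * expR 1 ^+ k.
  apply: le_trans (ler_wpM2l d2_ge0 (expn_le_fact_exp R k)) _.
  by rewrite mulrA ler_wpM2r ?exprn_ge0 ?expR_ge0.
rewrite -!exprMn => H.
(* Taking [2 / k] out of both sides reduces the goal to [H]. *)
have -> : d = 2 / k%:R * (d / 2 * k%:R) by field; rewrite gt_eqF.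
have -> : 2 * expR 1 / k%:R = 2 / k%:R * expR 1 :> R by rewrite mulrAC.
rewrite !exprMn -!mulrA ler_wpM2l ?exprn_ge0// ler_wpM2l ?exprn_ge0 ?invr_ge0//.
by move: H; rewrite exprMn [m * _]mulrC !exprMn -!mulrA.
Qed.

(** * Elementary inequalities for signatures (1,1) and (0,2) *)

(* [a] is the real root, [b +/- c i] the nonreal ones. *)
Lemma sqr_dist_le_signature11 (R : realFieldType) (a b c d A B : R) :
  0 <= d -> d ^+ 2 <= 4 * c ^+ 2 -> d ^+ 2 <= (a - b) ^+ 2 + c ^+ 2 ->
  1 <= A -> `|a| <= A -> 1 <= B -> b ^+ 2 + c ^+ 2 <= B ^+ 2 ->
  d ^+ 2 <= 3 * (A * B ^+ 2).
Proof.
move=> d_ge0 d_c d_ab A_ge1 aA B_ge1 bcB; rewrite leNgt; apply/negP => d_gt.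
have {}d_ab : d ^+ 2 <= A ^+ 2 + 2 * A * `|b| + B ^+ 2.
  have : (a - b) ^+ 2 = a ^+ 2 - 2 * (a * b) + b ^+ 2 by ring.
  have : `|a| ^+ 2 <= A ^+ 2 by rewrite lerXn2r// nnegrE; lra.
  have : `|a| * `|b| <= A * `|b| by rewrite ler_wpM2r.
  have := ler_norm (- (a * b)); rewrite normrN normrM real_normK ?num_real//.
  by move=> *; lra.
have b2 : `|b| ^+ 2 = b ^+ 2 by rewrite real_normK ?num_real.
have b_ge0 := normr_ge0 b.
have B2_ge1 : 1 <= B ^+ 2 by rewrite exprn_ege1.
have B_leB2 : B <= B ^+ 2 by rewrite expr2 ler_peMr//; lra.
(* From 3 A B^2 < d^2 <= 4 c^2 <= 4 (B^2 - b^2). *)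
have bB : 4 * `|b| ^+ 2 < (4 - 3 * A) * B ^+ 2 by rewrite b2; lra.
(* If A <= B, the crude bound |b| < B/2 suffices: d^2 <= A^2 + A B + B^2 <= 3 A B^2. *)
have [AB|BA] := leP A B.
  have b_lt : `|b| < B / 2.
    rewrite -(@ltr_pXn2r _ 2) ?nnegrE//; last lra.
    have : 1 * B ^+ 2 <= A * B ^+ 2 by rewrite ler_wpM2r//; lra.
    by rewrite expr_div_n; lra.
  have : A ^+ 2 <= A * B by rewrite expr2 ler_wpM2l//; lra.
  have : A * `|b| <= A * (B / 2) by rewrite ler_wpM2l//; lra.
  have : A * B <= A * B ^+ 2 by rewrite ler_wpM2l//; lra.
  have : 1 * B ^+ 2 <= A * B ^+ 2 by rewrite ler_wpM2r//; lra.
  by move=> *; lra.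
have A_lt : A < 4 / 3.
  rewrite ltNge; apply/negP => A_ge.
  have : (4 - 3 * A) * B ^+ 2 <= 0 by rewrite mulr_le0_ge0//; lra.
  by have := sqr_ge0 `|b|; lra.
(* [`|b| = q B]: in the bound [A^2 + 2 A B q + B^2] the worst case is [B = 1]. *)
pose q := `|b| / B.
have q_ge0 : 0 <= q by rewrite divr_ge0//; lra.
have bq : `|b| = q * B by rewrite divfK// gt_eqF//; lra.
have q2 : 4 * q ^+ 2 < 4 - 3 * A.
  rewrite -(@ltr_pM2r _ (B ^+ 2)); last lra.
  by rewrite -mulrA -exprMn -bq.
(* Equivalent to A^2 + 2 A q + 1 <= 3 A, the desired bound at B = 1. Both sides agree at A = 1, q =
   1/2, the values for the cube roots of 1. *)
have key : 2 * A * q <= 3 * A - 1 - A ^+ 2.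
  rewrite -(@ler_pXn2r _ 2) ?nnegrE//; [|by nra|by nra].
  have : (2 * A * q) ^+ 2 <= A ^+ 2 * (4 - 3 * A).
    have -> : (2 * A * q) ^+ 2 = A ^+ 2 * (4 * q ^+ 2) by ring.
    by rewrite ler_wpM2l ?sqr_ge0// ltW.
  move/le_trans; apply; rewrite -subr_ge0.
  have -> : (3 * A - 1 - A ^+ 2) ^+ 2 - A ^+ 2 * (4 - 3 * A)
            = (A - 1) * (A * (A - 1) ^+ 2 + (4 * A - 1)).
    by ring.
  have : 0 <= A * (A - 1) ^+ 2 by rewrite mulr_ge0 ?sqr_ge0//; lra.
  by move=> ?; rewrite mulr_ge0//; lra.
have : A ^+ 2 <= A ^+ 2 * B ^+ 2 by rewrite ler_peMr ?sqr_ge0.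
have : 2 * A * q * B ^+ 2 <= (3 * A - 1 - A ^+ 2) * B ^+ 2.
  by rewrite ler_wpM2r//; lra.
have : 2 * A * q * B <= 2 * A * q * B ^+ 2.
  by rewrite ler_wpM2l// mulr_ge0//; lra.
by move: d_ab; rewrite bq; lra.
Qed.

(* [b +/- c i] and [g +/- h i] are the two conjugate pairs of roots. *)
Lemma sqr_dist_le_signature02 (R : realFieldType) (b c g h D B G : R) :
  0 <= D -> D <= 4 * c ^+ 2 -> D <= 4 * h ^+ 2 ->
  D <= (b - g) ^+ 2 + (c - h) ^+ 2 -> D <= (b - g) ^+ 2 + (c + h) ^+ 2 ->
  0 <= B -> 0 <= G ->
  b ^+ 2 + c ^+ 2 <= B ^+ 2 -> g ^+ 2 + h ^+ 2 <= G ^+ 2 ->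
  D <= 2 * (B * G).
Proof.
move=> D_ge0 Dc Dh Dminus Dplus B_ge0 G_ge0 bcB ghG.
rewrite leNgt; apply/negP => D_gt.
set K := B * G in D_gt; set S := B ^+ 2 + G ^+ 2.
have K_ge0 : 0 <= K by rewrite mulr_ge0.
have S_ge : 2 * K <= S by have := sqr_ge0 (B - G); rewrite /S /K; nra.
have D2_gt : 4 * K ^+ 2 < D ^+ 2 by nra.
have ch : D / 4 <= `|c * h|.
  rewrite -(@ler_pXn2r _ 2) ?nnegrE//; last lra.
  rewrite real_normK ?num_real// exprMn.
  have : D * D <= 4 * c ^+ 2 * (4 * h ^+ 2) by rewrite ler_pM.
  by rewrite !expr2 => ?; lra.
(* The sign of [c * h] decides which of [Dminus] and [Dplus] to expand: the one whose cross term is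
   -2 |c h| <= -D/2. *)
have D_le : 3 / 2 * D - S <= 2 * `|b * g|.
  have := ler_norm (- (b * g)); rewrite normrN /S.
  by case: (leP 0 (c * h)) ch => [/ger0_norm|/ltr0_norm] -> ? ?; nra.
have bg : 4 * `|b * g| ^+ 2 <= 4 * ((B ^+ 2 - D / 4) * (G ^+ 2 - D / 4)).
  rewrite real_normK ?num_real// exprMn ler_pM2l// ler_pM ?sqr_ge0//; lra.
have rhs : 4 * ((B ^+ 2 - D / 4) * (G ^+ 2 - D / 4))
           = 4 * K ^+ 2 - S * D + D ^+ 2 / 4 by rewrite /K /S; field.
rewrite {}rhs in bg.
(* Positivity allows [D_le] to be squared. Were it to fail, S D >= 3/2 D^2 would make the upper
   bound in [bg] negative. *)
have D_S : 0 < 3 / 2 * D - S.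
  have := sqr_ge0 `|b * g|; rewrite ltNge => ?; apply/negP => ?.
  by have : 3 / 2 * D * D <= S * D by [rewrite ler_wpM2r//; lra]; nra.
have : (3 / 2 * D - S) ^+ 2 <= (2 * `|b * g|) ^+ 2.
  by rewrite lerXn2r// nnegrE; [exact: ltW|rewrite mulr_ge0].
have -> : (2 * `|b * g|) ^+ 2 = 4 * `|b * g| ^+ 2 by ring.
move=> /le_trans /(_ bg) quad.
(* [quad] says 2 D^2 - 2 S D + S^2 - 4 K^2 <= 0. The left side equals (S - 2K)^2 + 2 (D - 2K)^2 + 2
   (D - 2K) (4K - S), positive if S <= 4K, and also (2D - S)^2 / 2 + S^2 / 2 - 4 K^2, positive if S
   > 4K. *)
have := sqr_ge0 (S - 2 * K).
have [S_le|S_gt] := leP S (4 * K).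
  have : 0 <= (D - 2 * K) * (4 * K - S) by rewrite mulr_ge0; lra.
  have : 0 < (D - 2 * K) ^+ 2 by rewrite exprn_gt0; lra.
  by lra.
by have := sqr_ge0 (2 * D - S); nra.
Qed.

(** * Moduli, conjugate roots and separation *)

Lemma sqr_cmod (R : realType) (z : R[i]) :
  cmod z ^+ 2 = complex.Re z ^+ 2 + complex.Im z ^+ 2.
Proof. by rewrite /cmod normc_def /= sqr_sqrtr// addr_ge0 ?sqr_ge0. Qed.

Lemma cmod_ge0 (R : realType) (z : R[i]) : 0 <= cmod z.
Proof. by rewrite /cmod normc_def /= sqrtr_ge0. Qed.

Lemma cmod_Im0 (R : realType) (z : R[i]) :
  complex.Im z = 0 -> cmod z = `|complex.Re z|.
Proof. by move=> z0; rewrite /cmod normc_def z0 expr0n addr0 /= sqrtr_sqr. Qed.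

Lemma cmod_conj (R : realType) (z : R[i]) : cmod (z^*)%C = cmod z.
Proof. by rewrite /cmod normcJ. Qed.

Lemma croots_monicE (R : realType) (p : {poly R[i]}) :
  p \is monic -> p = \prod_(z <- croots p) ('X - z%:P).
Proof.
move=> /monicP p_monic; rewrite /croots.
by case: closed_field_poly_normal => r /= {1}->; rewrite p_monic scale1r.
Qed.

Lemma size_croots (R : realType) (p : {poly R[i]}) :
  p \is monic -> size (croots p) = (size p).-1.
Proof. by move=> /croots_monicE {2}->; rewrite size_prod_XsubC. Qed.

Lemma uniq_croots (R : realType) (p : {poly R[i]}) :
  p \is monic -> separable p -> uniq (croots p).
Proof.
move=> p_monic p_sep; rewrite -[uniq _]negbK -ltn_size_undup p_sep.
by rewrite size_croots// ltnn.
Qed.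

(** Conjugation fixes the real coefficients, hence permutes the roots. *)
Lemma mem_croots_conj (R : realType) (f : {poly R}) (z : R[i]) :
  f \is monic -> z \in croots (complexify f) -> (z^*)%C \in croots (complexify f).
Proof.
move=> f_monic.
have cf_monic : complexify f \is monic by rewrite /complexify map_monic.
have conj_f : map_poly conjc (complexify f) = complexify f.
  rewrite /complexify -map_poly_comp; apply: eq_map_poly => x /=.
  by rewrite /conjc /= oppr0.
rewrite -!root_prod_XsubC -!croots_monicE// -{1}conj_f.
by rewrite complex_root_conj.
Qed.

Lemma mem_root_distances (R : realType) (p : {poly R[i]}) (a b : R[i]) :
  a \in croots p -> b \in croots p -> a != b ->
  cmod (a - b) \in root_distances p.
Proof.
move=> a_p b_p ab; apply/mapP; exists (a, b) => //.
by rewrite mem_filter ab; apply/allpairsP; exists (a, b).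
Qed.

Lemma sep_le (R : realType) (p : {poly R[i]}) (a b : R[i]) :
  a \in croots p -> b \in croots p -> a != b -> sep p <= cmod (a - b).
Proof. by move=> a_p b_p ab; apply: ge_bigmin_seq => //; exact: mem_root_distances. Qed.

Lemma sep_ge0 (R : realType) (p : {poly R[i]}) : 0 <= sep p.
Proof.
have dist_ge0 d : d \in root_distances p -> 0 <= d.
  by move=> /mapP[ab _ ->]; exact: cmod_ge0.
rewrite /sep big_seq; elim/big_ind: _ => [|x y x0 y0|//].
  (* The initial value of the fold is either the default 0 or itself a distance. *)
  by case: root_distances dist_ge0 => //= d l; apply; rewrite mem_head.
by rewrite le_min x0.
Qed.

Lemma sep2_le (R : realType) (p : {poly R[i]}) (a b : R[i]) :
  a \in croots p -> b \in croots p -> a != b ->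
  sep p ^+ 2 <= (complex.Re a - complex.Re b) ^+ 2
                + (complex.Im a - complex.Im b) ^+ 2.
Proof.
move=> a_p b_p ab; apply: (@le_trans _ _ (cmod (a - b) ^+ 2)).
  by rewrite lerXn2r ?sep_le// nnegrE ?sep_ge0 ?cmod_ge0.
by rewrite sqr_cmod; case: a b {a_p b_p ab} => [a1 a2] [b1 b2].
Qed.

Lemma Im_conj (R : realType) (z : R[i]) : complex.Im (z^*)%C = - complex.Im z.
Proof. by case: z. Qed.

Lemma sqr_cmod_le_max1 (R : realType) (z : R[i]) :
  complex.Re z ^+ 2 + complex.Im z ^+ 2 <= Num.max 1 (cmod z) ^+ 2.
Proof.
by rewrite -sqr_cmod lerXn2r ?nnegrE ?cmod_ge0// le_max ?ler01 ?lexx ?orbT.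
Qed.

Lemma nonreal_neq_conj (R : realType) (z : R[i]) :
  complex.Im z != 0 -> z != (z^*)%C.
Proof.
case: z => a b /= b0; rewrite eq_complex /= eqxx /= eq_sym -subr_eq0.
by rewrite -opprD oppr_eq0 -mulr2n mulrn_eq0.
Qed.

Lemma sep2_le_Im (R : realType) (p : {poly R[i]}) (z : R[i]) :
  z \in croots p -> (z^*)%C \in croots p -> complex.Im z != 0 ->
  sep p ^+ 2 <= 4 * complex.Im z ^+ 2.
Proof.
move=> z_p zc_p z_nonreal; apply: le_trans (sep2_le _ _ _ _ z_p zc_p _) _.
  exact: nonreal_neq_conj.
by case: z {z_p zc_p z_nonreal} => a b /=; lra.
Qed.

(** Conjugation is an involution, so removing a root together with its conjugate leaves a list still
    closed under conjugation; the splitting can then be repeated. *)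
Lemma conj_pair_split (R : realType) (r : seq R[i]) :
  uniq r -> {in r, forall z, (z^*)%C \in r} ->
  has (fun z => complex.Im z != 0) r ->
  exists (z : R[i]) (r' : seq R[i]), [/\ complex.Im z != 0,
    perm_eq r [:: z, (z^*)%C & r'] & {in r', forall w, (w^*)%C \in r'}].
Proof.
move=> r_uniq r_conj /hasP[z z_r z_nonreal].
have zc_rem : (z^*)%C \in rem z r.
  by rewrite mem_rem_uniq// inE eq_sym nonreal_neq_conj// r_conj.
have r_split : perm_eq r [:: z, (z^*)%C & rem (z^*)%C (rem z r)].
  by rewrite (perm_trans (perm_to_rem z_r))// perm_cons perm_to_rem.
exists z, (rem (z^*)%C (rem z r)); split => // w.
rewrite !mem_rem_uniq ?rem_uniq// !inE !mem_rem_uniq// !inE.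
case/and3P => w_zc w_z /r_conj ->; rewrite andbT.
rewrite (inj_eq (can_inj (@conjcK R))) w_z /=.
by rewrite -[z in _ != z]conjcK (inj_eq (can_inj (@conjcK R))).
Qed.

(** * Separation bounds, signature by signature *)

Lemma sep_le_real (R : realType) (p : {poly R[i]}) :
  p \is monic -> separable p -> (2 <= size (croots p))%N ->
  all (fun z => complex.Im z == 0) (croots p) ->
  sep p <= 2 * expR 1 / (size (croots p)).-1%:R
           * mahler p `^ (size (croots p)).-1%:R^-1.
Proof.
move=> p_monic p_sep p_ge2 /allP p_real.
have Im0 z : z \in croots p -> complex.Im z = 0 by move=> /p_real/eqP.
have -> : mahler p =
    \prod_(x <- [seq complex.Re z | z <- croots p]) Num.max 1 `|x|.
  rewrite big_map /mahler big_seq [RHS]big_seq; apply: eq_bigr => z z_p.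
  by rewrite cmod_Im0// Im0.
rewrite -!(size_map (@complex.Re R) (croots p)).
apply: spaced_le_prod_powR; rewrite ?size_map ?sep_ge0//.
  rewrite map_inj_in_uniq ?uniq_croots// => -[a1 a2] [b1 b2].
  by move=> /Im0 /= -> /Im0 /= -> ->.
move=> _ _ /mapP[a a_p ->] /mapP[b b_p ->] ab.
have {}ab : a != b by apply: contra_neq ab => ->.
apply: le_trans (sep_le _ _ _ _ a_p b_p ab) _.
rewrite cmod_Im0; first by case: a b {a_p b_p ab} => [? ?] [? ?].
by move: (Im0 _ a_p) (Im0 _ b_p); case: a b {a_p b_p ab} => [? ?] [? ?] /= -> ->;
  rewrite subrr.
Qed.

Lemma sep2_le_signature11 (R : realType) (f : {poly R}) :
  f \is monic -> separable (complexify f) -> has_signature f 1 1 ->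
  sep (complexify f) ^+ 2 <= 3 * mahler (complexify f).
Proof.
move=> f_monic f_sep [count_real count_nonreal].
have cf_monic : complexify f \is monic by rewrite /complexify map_monic.
have r_uniq := uniq_croots _ _ cf_monic f_sep.
have r_conj : {in croots (complexify f), forall z, (z^*)%C \in croots (complexify f)}.
  by move=> z; exact: mem_croots_conj.
have r_has : has (fun z => complex.Im z != 0) (croots (complexify f)).
  by rewrite has_count count_nonreal.
have [z [r' [z_nonreal r_split _]]] := conj_pair_split _ _ r_uniq r_conj r_has.
have mem_r := perm_mem r_split.
have z_r : z \in croots (complexify f) by rewrite mem_r !inE eqxx.
have zc_r := r_conj _ z_r.
(* There are 1 + 2 = 3 roots in all, so exactly one remains beside the conjugate pair, and it must
   be the real one. *)
have := count_predC (fun z => complex.Im z == 0) (croots (complexify f)).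
rewrite count_real count_nonreal (perm_size r_split).
case: r' r_split mem_r => [|a []] // r_split mem_r _.
have a_r : a \in croots (complexify f) by rewrite mem_r !inE eqxx !orbT.
have a_real : complex.Im a = 0.
  apply/eqP; move: count_real; rewrite (permP r_split) /= Im_conj oppr_eq0.
  by rewrite (negPf z_nonreal); case: eqP.
have az : a != z by apply: contra_neq z_nonreal => <-.
have -> : mahler (complexify f)
          = Num.max 1 (cmod a) * Num.max 1 (cmod z) ^+ 2.
  rewrite /mahler (perm_big _ r_split) /= !big_cons big_nil cmod_conj.
  by ring.
apply: (@sqr_dist_le_signature11 _ (complex.Re a) (complex.Re z) (complex.Im z)).
- exact: sep_ge0.
- exact: sep2_le_Im.
- by have := sep2_le _ _ _ _ a_r z_r az; rewrite a_real sub0r sqrrN.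
- by rewrite le_max lexx.
- by rewrite -cmod_Im0// le_max lexx orbT.
- by rewrite le_max lexx.
- exact: sqr_cmod_le_max1.
Qed.

Lemma sep4_le_signature02 (R : realType) (f : {poly R}) :
  f \is monic -> separable (complexify f) -> has_signature f 0 2 ->
  sep (complexify f) ^+ 4 <= 4 * mahler (complexify f).
Proof.
move=> f_monic f_sep [count_real count_nonreal].
have cf_monic : complexify f \is monic by rewrite /complexify map_monic.
have r_uniq := uniq_croots _ _ cf_monic f_sep.
have r_conj : {in croots (complexify f), forall z, (z^*)%C \in croots (complexify f)}.
  by move=> z; exact: mem_croots_conj.
have r_has : has (fun z => complex.Im z != 0) (croots (complexify f)).
  by rewrite has_count count_nonreal.
have [z [r' [z_nonreal r_split r'_conj]]] := conj_pair_split _ _ r_uniq r_conj r_has.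
have r'_uniq : uniq r'.
  by move: r_uniq; rewrite (perm_uniq r_split) => /and3P[].
have r'_has : has (fun z => complex.Im z != 0) r'.
  rewrite has_count; move: count_nonreal; rewrite (permP r_split) /= Im_conj.
  by rewrite oppr_eq0 z_nonreal !add1n => -[->].
have [w [r'' [w_nonreal r'_split _]]] := conj_pair_split _ _ r'_uniq r'_conj r'_has.
have {r'_split}r_split : perm_eq (croots (complexify f)) [:: z, (z^*)%C, w, (w^*)%C & r''].
  by rewrite (perm_trans r_split)// !perm_cons.
(* With 0 + 4 roots in all, nothing remains after two conjugate pairs. *)
have := count_predC (fun z => complex.Im z == 0) (croots (complexify f)).
rewrite count_real count_nonreal (perm_size r_split).
case: r'' r_split => // r_split _.
have mem_r := perm_mem r_split.
have z_r : z \in croots (complexify f) by rewrite mem_r !inE eqxx.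
have w_r : w \in croots (complexify f) by rewrite mem_r !inE eqxx !orbT.
have zc_r := r_conj _ z_r; have wc_r := r_conj _ w_r.
have [zw zwc] : z != w /\ z != (w^*)%C.
  by move: r_uniq; rewrite (perm_uniq r_split) /= !inE !negb_or => /andP[/and3P[]].
have -> : mahler (complexify f)
          = (Num.max 1 (cmod z) * Num.max 1 (cmod w)) ^+ 2.
  rewrite /mahler (perm_big _ r_split) /= !big_cons big_nil !cmod_conj.
  by ring.
(* The Mahler measure is K^2, so the claim is the square of [sep _ ^+ 2 <= 2 * K]. *)
set K := Num.max 1 (cmod z) * _; rewrite -[4%N]/(2 * 2)%N exprM.
have -> : 4 * K ^+ 2 = (2 * K) ^+ 2 by ring.
have K_ge0 : 0 <= K by rewrite mulr_ge0// le_max ler01.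
rewrite lerXn2r ?nnegrE ?exprn_ge0 ?sep_ge0 ?(mulr_ge0 _ K_ge0)//.
apply: (@sqr_dist_le_signature02 _ (complex.Re z) (complex.Im z)
          (complex.Re w) (complex.Im w)).
- by rewrite exprn_ge0 ?sep_ge0.
- exact: sep2_le_Im.
- exact: sep2_le_Im.
- exact: sep2_le.
- have := sep2_le _ _ _ _ z_r wc_r zwc.
  by case: (w) => g h /=; rewrite opprK.
- by rewrite le_max ler01.
- by rewrite le_max ler01.
- exact: sqr_cmod_le_max1.
- exact: sqr_cmod_le_max1.
Qed.

Theorem theorem1p3 (R : realType) :
  exists eps : nat -> R,
    eps @ \oo --> (0 : R) /\
    forall (f : {poly R}) (n t s : nat),
      f \is monic ->
      size f = n.+1 ->
      (2 <= n)%N ->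
      separable (complexify f) ->
      has_signature f t s ->
      s = 0%N \/ (t, s) = (1%N, 1%N) \/ (t, s) = (0%N, 2%N) ->
      sep (complexify f)
        <= sep_const eps t s
           * mahler (complexify f) `^ (n%:R - delta R t)^-1.
Proof.
(* Chosen so that (2e + eps(t)) / t = 2e / (t - 1), the constant obtained for real roots. *)
exists (fun t => 2 * expR 1 / t.-1%:R); split.
  have c_cvg : (fun=> 2 * expR 1 : R) @ \oo --> (2 * expR 1 : R) by exact: cvg_cst.
  have : (fun k => 2 * expR 1 * harmonic k) @ \oo --> (2 * expR 1 * 0 : R).
    by apply: cvgM => //; exact: cvg_harmonic.
  (* Shifting by 2 turns 1 / (t - 1) into 1 / (k + 1), the harmonic sequence. *)
  rewrite mulr0 => h_cvg; rewrite -(cvg_shiftn 2 _ (nbhs (0 : R))); apply: cvg_trans h_cvg.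
  by apply: near_eq_cvg; near=> k; rewrite /= addn2.
move=> f n t s f_monic size_f n_ge2 f_sep f_sig t_s.
have cf_monic : complexify f \is monic by rewrite /complexify map_monic.
have size_r : size (croots (complexify f)) = n.
  by rewrite size_croots// size_map_poly size_f.
have n_eq : n = (t + s.*2)%N.
  rewrite -size_r -(count_predC (fun z => complex.Im z == 0)).
  by case: f_sig => <- <-.
have d_ge0 := sep_ge0 _ (complexify f).
case: t_s => [s0|[[t1 s1]|[t0 s2]]]; subst s.
- rewrite addn0 in n_eq; subst t.
  have -> : delta R n = 1 by rewrite /delta; case: n n_ge2 {size_f size_r f_sig}.
  have -> : n%:R - 1 = n.-1%:R :> R by rewrite -[n in LHS]prednK ?(ltnW n_ge2)// -natr1 addrK.
  have r_real : all (fun z => complex.Im z == 0) (croots (complexify f)).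
    by rewrite all_count size_r; case: f_sig => ->.
  have := sep_le_real _ _ cf_monic f_sep _ r_real; rewrite size_r => /(_ n_ge2).
  congr (_ <= _ * _).
  case: n n_ge2 {size_f size_r f_sig r_real} => [|[|n]] //= _.
  rewrite -[n.+2%:R]natr1; field; rewrite nat1r natr1.
  by rewrite !pnatr_eq0.
- subst t; rewrite n_eq /delta /= (_ : 3 - 1 = 2); last by ring.
  apply: (@le_mul_powR_inv _ _ _ _ 2); rewrite ?sqrtr_gt0//.
  by rewrite sqr_sqrtr// sep2_le_signature11.
(* The exponent is 1/4, and the fourth power of [Num.sqrt 2] is the 4 of the bound on
   [sep _ ^+ 4]. *)
- subst t; rewrite n_eq /delta /= subr0.
  apply: (@le_mul_powR_inv _ _ _ _ 4); rewrite ?sqrtr_gt0//.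
  rewrite -[in X in X * _](_ : 2 * 2 = 4)%N // exprM sqr_sqrtr// -natrX.
  exact: sep4_le_signature02.
Unshelve. all: by end_near.
Qed.
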